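(* Let $n\ge5$ and $\alpha,\beta\in\mathcal{E}_n=\mathrm{End}(\mathcal{T}_n)$. Then $\alpha\mathrel{\mathscr{L}^*}\beta$ if and only if one of the following occurs: (i) $\alpha,\beta\in\mathcal{G}_n$; (ii) $\alpha,\beta\in E_3\cup E_2\cup E_1$ and $\alpha=\beta$; or (iii) $\alpha,\beta\in A\cup B\cup C$ are such that $\alpha=\phi_{t,e}$, $\beta=\phi_{u,f}$ have the same type and $\mathrm{Fix}(t,e)=\mathrm{Fix}(u,f)$.
   Context: Maps are written on the right and composed left to right. $\mathcal{T}_n$ is the full transformation semigroup of all maps $\{1,\dots,n\}\to\{1,\dots,n\}$; $\mathcal{S}_n$, $\mathcal{A}_n$ are the symmetric and alternating groups, $\mathrm{id}$ the identity map, and $s^g=g^{-1}sg$ for $g\in\mathcal{S}_n$, $s\in\mathcal{T}_n$. $\mathcal{E}_n=\mathrm{End}(\mathcal{T}_n)$ is the monoid of all semigroup endomorphisms of $\mathcal{T}_n$ (not required to fix $\mathrm{id}$), and $\mathcal{G}_n=\mathrm{Aut}(\mathcal{T}_n)$. For $g\in\mathcal{S}_n$, $\psi_g:s\mapsto s^g$. For $t,e\in\mathcal{T}_n$, $\phi_{t,e}$ sends $s\mapsto t$ if $s\in\mathcal{S}_n\setminus\mathcal{A}_n$, $s\mapsto t^2$ if $s\in\mathcal{A}_n$, $s\mapsto e$ if $s\in\mathcal{T}_n\setminus\mathcal{S}_n$. By a known theorem of Schein and Teclezghi, $\mathcal{G}_n=\{\psi_g:g\in\mathcal{S}_n\}$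 and, for $n\neq4$, $\mathcal{E}_n=\mathcal{G}_n\cup\{\phi_{t,e}: t^3=t,\ te=et=e^2=e\}$. Define (in each case $\phi_{t,e}$ is assumed to lie in $\mathcal{E}_n$): $E_3=\{\phi_{t,e}: t\in\mathcal{S}_n\setminus\mathcal{A}_n,\ e\ne\mathrm{id}\}$; $A=\{\phi_{t,e}: t\in\mathcal{A}_n,\ t\neq\mathrm{id},\ e\neq\mathrm{id}\}$; $B=\{\phi_{t,e}: t\in\mathcal{T}_n\setminus\mathcal{S}_n,\ t\ne t^2,\ t^2\neq e,\ e\ne\mathrm{id}\}$; $E_2=\{\phi_{\mathrm{id},e}: e\ne\mathrm{id}\}$; $C=\{\phi_{t,e}: t\in\mathcal{T}_n\setminus\mathcal{S}_n,\ t=t^2,\ t\neq e,\ e\neq\mathrm{id}\}$; $E_1=\{\phi_{e,e}\}$. Elements of $E_3$ have odd type, those of $A\cup E_2$ even type, those of $B\cup C\cup(E_1\setminus\{\phi_{\mathrm{id},\mathrm{id}}\})$ non-permutation type, $\phi_{\mathrm{id},\mathrm{id}}$ trivial type, and automorphisms group type. $\mathrm{Fix}(t,e)=\{g\in\mathcal{S}_n: t^g=t\text{ and }e^g=e\}$. The relation $\mathscr{L}^*$ on $\mathcal{E}_n$: $\alpha\mathrel{\mathscr{L}^*}\beta$ iff for all $\gamma,\delta\in\mathcal{E}_n$, $\alpha\gamma=\alpha\delta\Leftrightarrow\beta\gamma=\beta\delta$. *)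

(* Defs.v *)
From HB Require Import structures.
From mathcomp Require Import all_boot all_order all_fingroup all_solvable.
Set Implicit Arguments.
Unset Strict Implicit.
Unset Printing Implicit Defensive.
Local Open Scope group_scope.

(* A wrapper around {ffun 'I_n -> 'I_n}, because finite functions already carry
   the pointwise product of their codomain as canonical product. *)
Record transf (n : nat) : Type :=
  Transf { fun_of_transf :> {ffun 'I_n -> 'I_n} }.

HB.instance Definition _ n := [isNew for @fun_of_transf n].
HB.instance Definition _ n := [Finite of transf n by <:].

Section TransfMonoid.
Variable n : nat.
Implicit Types s t u : transf n.

(* Maps act on the right: in [s * t], [s] is applied first. *)
Definition transf_mul s t : transf n := Transf [ffun x => t (s x)].
Definition transf_one : transf n := Transf [ffun x => x].

Lemma transf_eqP s t : (forall x, s x = t x) -> s = t.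
Proof. by move=> st; apply/val_inj/ffunP. Qed.

Lemma transf_mulA : associative transf_mul.
Proof. by move=> s t u; apply: transf_eqP => x; rewrite !ffunE. Qed.

Lemma transf_mul1 : left_id transf_one transf_mul.
Proof. by move=> s; apply: transf_eqP => x; rewrite !ffunE. Qed.

Lemma transf_mulr1 : right_id transf_one transf_mul.
Proof. by move=> s; apply: transf_eqP => x; rewrite !ffunE. Qed.

End TransfMonoid.

HB.instance Definition _ n :=
  isMonoid.Build (transf n) (@transf_mulA n) (@transf_mul1 n) (@transf_mulr1 n).

Definition perm_transf n (g : 'S_n) : transf n := Transf [ffun x => g x].

Definition Sn n : {set transf n} := [set perm_transf g | g : 'S_n].
Definition An n : {set transf n} := [set perm_transf g | g in 'Alt_('I_n)].

Definition transf_conj n (s : transf n) (g : 'S_n) : transf n :=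
  perm_transf g^-1 * s * perm_transf g.

Definition Fix n (t e : transf n) : {set 'S_n} :=
  [set g | (transf_conj t g == t) && (transf_conj e g == e)].

(* Semigroup endomorphisms: the identity need not be preserved. *)
Record endo (n : nat) : Type := Endo {
  fun_of_endo :> {ffun transf n -> transf n};
  _ : [forall s : transf n, forall t : transf n,
         fun_of_endo (s * t) == fun_of_endo s * fun_of_endo t] }.

HB.instance Definition _ n := [isSub for @fun_of_endo n].
HB.instance Definition _ n := [Finite of endo n by <:].

Section EndoMonoid.
Variable n : nat.
Implicit Types a b c : endo n.

Lemma endoM a (s t : transf n) : a (s * t) = a s * a t.
Proof. by case: a => f /= /forallP/(_ s)/forallP/(_ t)/eqP. Qed.

Lemma endo_eqP a b : (forall s, a s = b s) -> a = b.
Proof. by move=> ab; apply/val_inj/ffunP. Qed.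

Lemma endo_mul_subproof a b :
  [forall s : transf n, forall t : transf n,
     [ffun u : transf n => b (a u)] (s * t)
       == [ffun u => b (a u)] s * [ffun u => b (a u)] t].
Proof. by apply/forallP=> s; apply/forallP=> t; rewrite !ffunE !endoM. Qed.

Lemma endo_one_subproof :
  [forall s : transf n, forall t : transf n,
     [ffun u : transf n => u] (s * t)
       == [ffun u => u] s * [ffun u => u] t].
Proof. by apply/forallP=> s; apply/forallP=> t; rewrite !ffunE. Qed.

(* In [a * b], [a] is applied first. *)
Definition endo_mul a b : endo n := Endo (endo_mul_subproof a b).
Definition endo_one : endo n := Endo endo_one_subproof.

Lemma endo_mulA : associative endo_mul.
Proof. by move=> a b c; apply: endo_eqP => s; rewrite !ffunE. Qed.

Lemma endo_mul1 : left_id endo_one endo_mul.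
Proof. by move=> a; apply: endo_eqP => s; rewrite !ffunE. Qed.

Lemma endo_mulr1 : right_id endo_one endo_mul.
Proof. by move=> a; apply: endo_eqP => s; rewrite !ffunE. Qed.

End EndoMonoid.

HB.instance Definition _ n :=
  isMonoid.Build (endo n) (@endo_mulA n) (@endo_mul1 n) (@endo_mulr1 n).

Definition Lstar (M : monoidType) (a b : M) : Prop :=
  forall c d : M, a * c = a * d <-> b * c = b * d.

Definition phi n (t e : transf n) : {ffun transf n -> transf n} :=
  [ffun s => if s \in Sn n :\: An n then t
             else if s \in An n then t ^+ 2 else e].

Section EndoClasses.
Variable n : nat.
Implicit Types (a b : endo n) (t e : transf n).

Definition is_aut a : Prop := bijective a.

(* Only those maps [phi t e] that are endomorphisms are members, since the set
   ranges over [endo n]. *)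
Definition phi_set (P : rel (transf n)) : {set endo n} :=
  [set a : endo n |
    [exists t, exists e, P t e && (fun_of_endo a == phi t e)]].

Definition E3 : {set endo n} :=
  phi_set (fun t e => (t \in Sn n :\: An n) && (e != 1)).
Definition classA : {set endo n} :=
  phi_set (fun t e => [&& t \in An n, t != 1 & e != 1]).
Definition classB : {set endo n} :=
  phi_set (fun t e => [&& t \notin Sn n, t != t ^+ 2, t ^+ 2 != e & e != 1]).
Definition E2 : {set endo n} :=
  phi_set (fun t e => (t == 1) && (e != 1)).
Definition classC : {set endo n} :=
  phi_set (fun t e => [&& t \notin Sn n, t == t ^+ 2, t != e & e != 1]).
Definition E1 : {set endo n} := phi_set (fun t e => t == e).
Definition phi_id : {set endo n} :=
  phi_set (fun t e => (t == 1) && (e == 1)).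

Variant endo_type : Set :=
  GroupType | OddType | EvenType | NonPermType | TrivialType.

Definition has_type a (ty : endo_type) : Prop :=
  match ty with
  | GroupType => is_aut a
  | OddType => a \in E3
  | EvenType => a \in classA :|: E2
  | NonPermType => a \in classB :|: classC :|: (E1 :\: phi_id)
  | TrivialType => a \in phi_id
  end.

Definition same_type a b : Prop :=
  exists ty, has_type a ty /\ has_type b ty.

End EndoClasses.

Arguments E1 {n}.
Arguments E2 {n}.
Arguments E3 {n}.
Arguments classA {n}.
Arguments classB {n}.
Arguments classC {n}.

(* Main.v *)
Require Import Defs.
From HB Require Import structures.
From mathcomp Require Import all_boot all_order all_fingroup all_solvable.

Set Implicit Arguments.
Unset Strict Implicit.
Unset Printing Implicit Defensive.

(** The argument has two halves.

    The first is the theorem of Schein and Teclezghi for [5 <= n]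
    ([endo_cases]): an endomorphism [a] is either conjugation by a permutation
    or one of the maps [phi t e].  The two cases are told apart by the
    restriction of [a] to the symmetric group.
    - If [a] is injective there, counting forces the image of the symmetric
      group to be the whole symmetric group.  A constant map is a right zero,
      and only constants absorb every permutation on the left, so [a] maps
      constants to constants.  It thereby permutes the points
      and, as a transformation is determined by its action on constants, [a] is
      conjugation by that permutation ([endo_inner]).
    - Otherwise the kernel on the symmetric group is a nontrivial normal
      subgroup, and contains the alternating group because the latter is simple
      and the centre is trivial ([ker_sub_Alt]).  The image of an idempotent
      [merge x y] of defect one then absorbs the images of all permutations, and
      a singular map is a product of such idempotents and a permutation, so all
      singular maps have the same image ([endo_sing]): [a] is some [phi t e].

    The second half computes the left kernel [{(c, d) | a * c = a * d}].  If [a]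
    is an automorphism it is the equality, and by finiteness only then
    ([cancel_aut]).  If [a = phi t e], then [a * c = a * d] says that [c] and
    [d] agree on [t] and on [e].  Two conjugations satisfy this when they differ
    by an element of [Fix t e]; two maps [phi v k] satisfy it depending only on
    whether [t] and [e] are odd, even or singular.  What separates the classes is whether
    some conjugation is related to some [phi v k].
    - In [E1], [E2] and [E3] the map [a] is idempotent, so [1] and [a] are
      related ([not_rigid_idem]).  For two [Lstar]-related idempotents,
      [a = a * b] and [b = b * a], which for maps [phi] forces [a = b]
      ([phi_mul_absorb_eq]).
    - In [classA], [classB] and [classC], there is no such relation
      ([rigid_not_mixed]), so the left kernel is described by [Fix t e] and the
      type alone ([rigid_transfer]), and conversely it determines both
      ([Lstar_Fix], [Lstar_An]). *)

(** * Permutations, constants and idempotents of defect one *)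

Section Transformations.
Local Open Scope group_scope.
Variable n : nat.
Implicit Types (s t e u f v k : transf n) (g h : 'S_n) (x y z : 'I_n).

Lemma transfM s t x : (s * t) x = t (s x).
Proof. by rewrite ffunE. Qed.

Lemma transf1 x : (1 : transf n) x = x.
Proof. by rewrite ffunE. Qed.

Lemma perm_transfE g x : perm_transf g x = g x.
Proof. by rewrite ffunE. Qed.

Lemma perm_transfM g h : perm_transf (g * h) = perm_transf g * perm_transf h.
Proof. by apply: transf_eqP => x; rewrite transfM !perm_transfE permM. Qed.

Lemma perm_transf1 : perm_transf (1 : 'S_n) = 1.
Proof. by apply: transf_eqP => x; rewrite perm_transfE transf1 perm1. Qed.

Lemma perm_transfV g : perm_transf g * perm_transf g^-1 = 1.
Proof. by rewrite -perm_transfM mulgV perm_transf1. Qed.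

Lemma perm_transfVl g : perm_transf g^-1 * perm_transf g = 1.
Proof. by rewrite -perm_transfM mulVg perm_transf1. Qed.

Lemma perm_transf_inj : injective (@perm_transf n).
Proof.
move=> g h gh; apply/permP=> x.
by rewrite -!perm_transfE gh.
Qed.

Lemma perm_in_Sn g : perm_transf g \in Sn n.
Proof. exact: imset_f. Qed.

Lemma perm_in_An g : (perm_transf g \in An n) = ~~ g.
Proof. by rewrite (mem_imset _ _ perm_transf_inj) Alt_even. Qed.

Lemma An_Sn t : t \in An n -> t \in Sn n.
Proof. by case/imsetP=> g _ ->; apply: perm_in_Sn. Qed.

Lemma one_in_An : (1 : transf n) \in An n.
Proof. by rewrite -perm_transf1 perm_in_An odd_perm1. Qed.

Lemma one_in_Sn : (1 : transf n) \in Sn n.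
Proof. exact: An_Sn one_in_An. Qed.

Lemma in_Sn_inj s : reflect (injective s) (s \in Sn n).
Proof.
apply: (iffP imsetP) => [[g _ ->] x y | s_inj].
  by rewrite !perm_transfE => /perm_inj.
exists (perm s_inj) => //.
by apply: transf_eqP => x; rewrite perm_transfE permE.
Qed.

Lemma Sn_mull s t : s * t \in Sn n -> s \in Sn n.
Proof.
move/in_Sn_inj=> st_inj; apply/in_Sn_inj=> x y sxy.
by apply: st_inj; rewrite !transfM sxy.
Qed.

Lemma Sn_mulr s t : s * t \in Sn n -> t \in Sn n.
Proof.
move=> stS; have /imsetP[g _ sE] := Sn_mull stS.
have /in_Sn_inj st_inj := stS.
suff ->: t = perm_transf g^-1 * (s * t).
  apply/in_Sn_inj=> x y; rewrite !(transfM (perm_transf _)).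
  by move/st_inj; rewrite !perm_transfE => /perm_inj.
by rewrite sE mulgA perm_transfVl mul1g.
Qed.

Lemma Sn_idem e : e \in Sn n -> e * e = e -> e = 1.
Proof.
case/imsetP=> g _ ->; rewrite -perm_transfM -{3}[g]mulg1.
by move/perm_transf_inj/mulgI->; rewrite perm_transf1.
Qed.

Definition const_transf x : transf n := Transf [ffun=> x].

Lemma const_transfE x y : const_transf x y = x.
Proof. by rewrite ffunE. Qed.

Lemma mul_const s x : s * const_transf x = const_transf x.
Proof. by apply: transf_eqP => y; rewrite transfM !const_transfE. Qed.

Lemma const_mul s x : const_transf x * s = const_transf (s x).
Proof. by apply: transf_eqP => y; rewrite transfM !const_transfE. Qed.

Lemma const_transf_inj (x0 : 'I_n) : injective const_transf.
Proof.
by move=> x y /(congr1 (fun s : transf n => s x0)); rewrite !const_transfE.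
Qed.

Definition merge x y : transf n := Transf [ffun w => if w == x then y else w].

Lemma mergeE x y w : merge x y w = if w == x then y else w.
Proof. by rewrite ffunE. Qed.

Lemma merge_sing x y : x != y -> merge x y \notin Sn n.
Proof.
move=> xy; apply/in_Sn_inj => /(_ x y); rewrite !mergeE eqxx eq_sym (negPf xy).
by move/(_ erefl) => E; rewrite E eqxx in xy.
Qed.

Lemma merge_idem x y : merge x y * merge x y = merge x y.
Proof.
apply: transf_eqP => w; rewrite transfM !mergeE.
by case: (w =P x) => [_|/eqP/negPf->] //; case: eqP.
Qed.

Lemma conj_merge g x y :
  perm_transf g^-1 * merge x y * perm_transf g = merge (g x) (g y).
Proof.
apply: transf_eqP => w; rewrite !transfM !perm_transfE !mergeE.
rewrite (canF_eq (permKV g)); case: eqP => // _; exact: permKV.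
Qed.

Lemma tperm_merge x y : perm_transf (tperm x y) * merge x y = merge x y.
Proof.
apply: transf_eqP => w; rewrite transfM perm_transfE !mergeE.
case: tpermP => [->|->|/eqP/negPf-> //]; rewrite eqxx; first by case: eqP.
by case: eqP.
Qed.

Lemma perm_conj_mul s t g :
  transf_conj (s * t) g = transf_conj s g * transf_conj t g.
Proof.
rewrite /transf_conj !mulgA; congr (_ * _ * _).
by rewrite -[RHS]mulgA -!mulgA perm_transfV mulg1.
Qed.

End Transformations.

(** * The endomorphisms phi and the conjugations *)

Section Phi.
Local Open Scope group_scope.
Variable n : nat.
Implicit Types (s t e u f v k : transf n) (g h : 'S_n) (x y z : 'I_n).

Lemma phi_odd t e s : s \in Sn n -> s \notin An n -> phi t e s = t.
Proof. by move=> sS sA; rewrite ffunE inE sS sA. Qed.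

Lemma phi_even t e s : s \in An n -> phi t e s = t * t.
Proof. by move=> sA; rewrite ffunE inE sA /= expg2. Qed.

Lemma phi_sing t e s : s \notin Sn n -> phi t e s = e.
Proof.
move=> sS; rewrite ffunE inE (negPf sS) andbF ifN //.
exact: contra (@An_Sn _ _) sS.
Qed.

Definition phi_pair t e : Prop :=
  [/\ t * t * t = t, t * e = e, e * t = e & e * e = e].

(** The four identities are what the parity of permutations and the ideal of
   singular maps require: [t] and [t * t] multiply like the two parities because
   [t ^+ 3 = t], and [e] absorbs them as a singular factor absorbs permutations. *)
Lemma phiM t e s s' : phi_pair t e -> phi t e (s * s') = phi t e s * phi t e s'.
Proof.
case=> ttt te et ee.
have [/imsetP[g _ ->]|sS] := boolP (s \in Sn n); last first.
  rewrite [LHS]phi_sing; last by apply: contra sS; apply: Sn_mull.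
  rewrite phi_sing // ffunE; case: ifP => _ //; case: ifP => _ //.
  by rewrite expg2 mulgA !et.
have [/imsetP[h _ ->]|sS'] := boolP (s' \in Sn n); last first.
  rewrite [LHS]phi_sing; last by apply: contra sS'; apply: Sn_mulr.
  rewrite [X in _ = _ * X]phi_sing // ffunE; case: ifP => _ //; case: ifP => _ //.
  by rewrite expg2 -mulgA !te.
rewrite -perm_transfM !ffunE !inE !perm_in_Sn !perm_in_An odd_permM.
by case: (odd_perm g); case: (odd_perm h); rewrite /= ?expg2 ?mulgA ?ttt.
Qed.

Lemma phi_endo_subproof t e : phi_pair t e ->
  [forall s : transf n, forall s' : transf n,
     phi t e (s * s') == phi t e s * phi t e s'].
Proof. by move=> te; apply/forallP=> s; apply/forallP=> s'; apply/eqP/phiM. Qed.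

Definition phi_endo t e (te : phi_pair t e) : endo n :=
  Endo (phi_endo_subproof te).

Lemma conj_endo_subproof g :
  [forall s : transf n, forall s' : transf n,
     [ffun s => transf_conj s g] (s * s') ==
       [ffun s => transf_conj s g] s * [ffun s => transf_conj s g] s'].
Proof.
by apply/forallP=> s; apply/forallP=> s'; rewrite !ffunE perm_conj_mul.
Qed.

Definition conj_endo g : endo n := Endo (conj_endo_subproof g).

Lemma conj_endoE g s : conj_endo g s = transf_conj s g.
Proof. by rewrite ffunE. Qed.

End Phi.

(** * Classification of the endomorphisms *)

Section Classification.
Local Open Scope group_scope.
Variables (n : nat) (n_ge5 : (5 <= n)%N) (a : endo n).
Implicit Types (s t e u f v k : transf n) (g h : 'S_n) (x y z : 'I_n).

Lemma third_point x y : exists2 z, z != x & z != y.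
Proof.
have /subsetPn[z _] : ~~ ([set: 'I_n] \subset [set x; y]).
  apply: contraL n_ge5 => /subset_leq_card; rewrite cardsT card_ord cards2 -ltnNge.
  by move/leq_ltn_trans; apply; case: (x != y).
by rewrite !inE negb_or => /andP[]; exists z.
Qed.

Lemma endo1l s : a 1 * a s = a s. Proof. by rewrite -endoM mul1g. Qed.
Lemma endo1r s : a s * a 1 = a s. Proof. by rewrite -endoM mulg1. Qed.

Section InjectiveOnPermutations.
Hypothesis a_inj : injective (fun g => a (perm_transf g)).

Let im1 x := a 1 x == x.

(** The image of a permutation lies in the group of units of the local monoid of
   the idempotent [a 1], that is, it permutes the image [im1] of [a 1].
   Extending it by the identity off this image gives a permutation of all points. *)
Let unit_part g x := if im1 x then a (perm_transf g) x else x.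

Lemma unit_part_inj g : injective (unit_part g).
Proof.
have cl x h : im1 (a (perm_transf h) x) by rewrite /im1 -transfM endo1r.
have back x : im1 x -> a (perm_transf g^-1) (a (perm_transf g) x) = x.
  by move/eqP=> x1; rewrite -transfM -endoM perm_transfV.
move=> x y; rewrite /unit_part.
case: ifPn => x1; case: ifPn => y1 //.
- by move=> E; rewrite -(back x) // E back.
- by move=> E; rewrite -E cl in y1.
- by move=> E; rewrite E cl in x1.
Qed.

(** The assignment of [unit_part g] to [g] is an injection of the finite symmetric
   group into itself, so it is onto.  Every permutation then fixes the points outside [im1], and there are none. *)
Lemma endo_perm_onto h : exists g, a (perm_transf g) = perm_transf h.
Proof.
pose p g := perm (@unit_part_inj g).
have p_inj : injective p.
  move=> g g' gg'; apply: a_inj; apply: transf_eqP => x.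
  have x1 : im1 (a 1 x) by rewrite /im1 -transfM endo1l.
  have := congr1 (fun h : 'S_n => h (a 1 x)) gg'.
  by rewrite !permE /unit_part x1 -!transfM !endo1l.
have p_onto h' : exists g, p g = h'.
  by have /codomP[g ->] := injF_onto p_inj h'; exists g.
have all1 z : im1 z.
  apply: contraT => z1; have [w wz _] := third_point z z.
  have [g gE] := p_onto (tperm z w).
  have := congr1 (fun h : 'S_n => h z) gE.
  by rewrite permE /unit_part (negPf z1) tpermL => E; rewrite E eqxx in wz.
have [g gE] := p_onto h; exists g; apply: transf_eqP => x.
by rewrite perm_transfE -gE permE /unit_part all1.
Qed.

(** If two constants were identified, double transitivity would identify all of
   them, and a value of the common image would be fixed by every permutation. *)
Lemma endo_const_inj : injective (fun x => a (const_transf x)).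
Proof.
move=> x y axy; apply/eqP/contraT=> xy.
have [z zx zy] := third_point x y.
have same g : a (const_transf (g x)) = a (const_transf (g y)).
  by rewrite -[g x]perm_transfE -[g y]perm_transfE -!const_mul !endoM axy.
have all_eq w : a (const_transf w) = a (const_transf x).
  have [->//|wx] := eqVneq w x.
  have := same (tperm y w); rewrite tpermL tpermD // 1?eq_sym // => ->.
pose c := a (const_transf x) x.
have [w wc _] := third_point c c.
have [g gE] := endo_perm_onto (tperm c w).
have: a (const_transf x) * perm_transf (tperm c w) = a (const_transf x).
  by rewrite -gE -endoM const_mul all_eq.
move/(congr1 (fun s : transf n => s x)); rewrite transfM perm_transfE -/c tpermL.
by move=> E; rewrite E eqxx in wc.
Qed.

(** Constants absorb every map on their left, hence their images absorb every
   permutation on the left and are constant too.  The action of [a s] on constants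
   is then read off from that of [s]. *)
Lemma endo_inner : exists g, a = conj_endo g.
Proof.
have x0 : 'I_n := Ordinal (ltn_trans (isT : 0 < 4)%N n_ge5).
pose q x := a (const_transf x) x0.
have aq x : a (const_transf x) = const_transf (q x).
  apply: transf_eqP => y; rewrite const_transfE /q.
  have [g gE] := endo_perm_onto (tperm x0 y).
  rewrite -[in RHS](mul_const (perm_transf g)) endoM gE transfM perm_transfE.
  by rewrite tpermL.
have q_inj : injective q.
  by move=> x y xy; apply: endo_const_inj; rewrite !aq xy.
exists (perm q_inj); apply: endo_eqP => s; rewrite conj_endoE.
apply: transf_eqP => y; rewrite /transf_conj !transfM !perm_transfE.
set x := (perm q_inj)^-1%g y; have -> : y = q x by rewrite -(permE q_inj) permKV.
rewrite permE; apply: (@const_transf_inj _ x0).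
by rewrite -const_mul -aq -endoM const_mul aq.
Qed.
End InjectiveOnPermutations.

Section NotInjectiveOnPermutations.
Hypothesis a_ninj : ~ injective (fun g => a (perm_transf g)).

Let ker_set : {set 'S_n} := [set g | a (perm_transf g) == a 1].

Lemma ker_group : group_set ker_set.
Proof.
apply/group_setP; split=> [|g h]; first by rewrite inE perm_transf1.
rewrite !inE => /eqP g1 /eqP h1.
by rewrite perm_transfM endoM g1 h1 endo1l.
Qed.
Let K := Group ker_group.

Lemma ker_conj g h : g \in K -> g ^ h \in K.
Proof.
rewrite !inE => /eqP g1.
by rewrite conjgE !perm_transfM !endoM g1 endo1l -endoM perm_transfVl.
Qed.

Lemma ker_nontrivial : exists2 g, g \in K & g != 1.
Proof.
have [/existsP[g /andP[]]|/existsPn noK] :=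
  boolP [exists g, (g \in K) && (g != 1)]; first by exists g.
case: a_ninj => g h gh.
have: g * h^-1 \in K.
  by rewrite inE perm_transfM endoM gh -endoM perm_transfV.
move: (noK (g * h^-1)) => /negPf; case: (_ \in K) => //= /negbFE/eqP.
by move/(canRL (mulgKV h)); rewrite mul1g.
Qed.

(** The commutator of a nontrivial kernel element with a suitable transposition
   lies in the kernel, is even and is nontrivial; by simplicity its normal closure
   in the alternating group is the whole group. *)
Lemma ker_sub_Alt : 'Alt_('I_n) \subset K.
Proof.
have [g gK g1] := ker_nontrivial.
have [x gx] : exists x, g x != x.
  apply/existsP; apply: contraNT g1; rewrite negb_exists => /forallP gx.
  by apply/eqP/permP=> x; rewrite perm1; have := gx x; rewrite negbK => /eqP.
have [z zx zgx] := third_point x (g x).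
(* The transposition fixes x and moves g x, so that conjugation by it changes
   the image of x under g. *)
pose c := [~ g, tperm (g x) z].
have cK : c \in K by rewrite /c commgEl groupM ?groupV // ker_conj.
have cA : c \in 'Alt_('I_n).
  rewrite Alt_even /c commgEl conjgE !odd_permM !odd_permV.
  by case: (odd_perm g); case: (odd_perm (tperm _ _)).
have c1 : c != 1.
  apply: contra_neq zgx; rewrite /c commgEl => /(canRL (mulVKg g)); rewrite mulg1.
  move=> /(congr1 (fun h : 'S_n => h x)) <-.
  have := permJ g (tperm (g x) z) x.
  by rewrite tpermL tpermD // eq_sym.
have /simpleP[_ Alt_minimal] : simple 'Alt_('I_n).
  by apply: simple_Alt5; rewrite card_ord.
have nKA : (K :&: 'Alt_('I_n))%G <| 'Alt_('I_n).
  apply/andP; split; first exact: subsetIr.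
  apply/subsetP=> h hA; rewrite inE; apply/subsetP=> _ /imsetP[k + ->].
  case/setIP=> kK kA; apply/setIP; split; [exact: ker_conj | by rewrite groupJ].
have [KA1|KA] := Alt_minimal _ nKA; last by rewrite -KA subsetIl.
have : c \in (K :&: 'Alt_('I_n))%G by rewrite inE cK.
by rewrite KA1 inE (negPf c1).
Qed.

Lemma endo_even g : ~~ g -> a (perm_transf g) = a 1.
Proof.
move=> g_even; apply/eqP; have /subsetP/(_ g) := ker_sub_Alt.
by rewrite Alt_even inE; apply.
Qed.

Lemma endo_odd g h : g -> h -> a (perm_transf g) = a (perm_transf h).
Proof.
move=> g_odd h_odd; rewrite -[g](mulgKV h) perm_transfM endoM endo_even ?endo1l //.
by rewrite odd_permM odd_permV g_odd h_odd.
Qed.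

Section Merge.
Variables x y : 'I_n.
Hypothesis xy : x != y.
Let u := a (merge x y).

Lemma perm_mul_merge g : a (perm_transf g) * u = u.
Proof.
have [g_odd|g_even] := boolP (odd_perm g).
  by rewrite (@endo_odd _ (tperm x y)) ?odd_tperm // -endoM tperm_merge.
by rewrite endo_even // endo1l.
Qed.

(** All odd permutations have the same image, so one suffices; and as [5 <= n] leaves two
   points besides [x] and [y], a transposition can be chosen that commutes with
   [merge x y]. *)
Lemma merge_mul_perm g : u * a (perm_transf g) = u.
Proof.
have [g_odd|g_even] := boolP (odd_perm g); last by rewrite endo_even // endo1r.
have [z zx zy] := third_point x y.
have [w wxy wz] : exists2 w, w \notin [set x; y] & w != z.
  have /subsetPn[w _] : ~~ ([set: 'I_n] \subset z |: [set x; y]).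
    apply: contraL n_ge5 => /subset_leq_card; rewrite cardsT card_ord -ltnNge.
    rewrite cardsU1 cards2 => /leq_ltn_trans; apply.
    by case: (z \notin _); case: (x != y).
  by rewrite !inE negb_or => /andP[wz wxy]; exists w; rewrite ?inE.
move: wxy; rewrite !inE negb_or => /andP[wx wy].
rewrite (@endo_odd _ (tperm w z)) ?odd_tperm //.
have uJ : u = a (perm_transf (tperm w z)^-1) * u * a (perm_transf (tperm w z)).
  by rewrite -!endoM conj_merge !tpermD // eq_sym.
by rewrite [RHS]uJ perm_mul_merge.
Qed.

(** Any two of these idempotents are conjugate. *)
Lemma merge_conj_eq x' y' : x' != y' -> a (merge x' y') = u.
Proof.
move=> xy'.
have [g [<- <-]] : exists g : 'S_n, g x = x' /\ g y = y'.
  exists (tperm x x' * tperm (tperm x x' y) y').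
  rewrite !permM tpermL; split; last by rewrite tpermL.
  have side : tperm x x' y != x'.
    by rewrite -{2}(tpermL x x') (inj_eq perm_inj) eq_sym.
  by rewrite (tpermD side) // eq_sym.
by rewrite -conj_merge !endoM perm_mul_merge merge_mul_perm.
Qed.

(** Induction on the number of points missing from the image: if [s] identifies
   [x'] and [y'], then [s] is [merge x' y'] followed by a map that agrees with [s]
   except that it sends [x'] to a missing point. *)
Lemma endo_sing s : s \notin Sn n -> a s = u.
Proof.
have [m] := ubnP #|~: [set s i | i : 'I_n]|; elim: m s => // m IH s lt_m s_sing.
have [x' [y' [xy' sxy]]] : exists x' y', x' != y' /\ s x' = s y'.
  have := s_sing; rewrite (sameP (in_Sn_inj s) (injectiveP _)) => /injectivePn.
  by case=> x' [y' xy' sxy]; exists x', y'.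
have [z z_im] : exists z, z \in ~: [set s i | i : 'I_n].
  apply/set0Pn; apply: contra s_sing => /eqP imT; apply/in_Sn_inj.
  have im_card : #|[set s i | i : 'I_n]| = #|'I_n|.
    by rewrite -[RHS](cardsC [set s i | i : 'I_n]) imT cards0 addn0.
  by move=> i j; apply: (imset_injP (introT eqP im_card)).
pose s' : transf n := Transf [ffun i => if i == x' then z else s i].
have sE : s = merge x' y' * s'.
  apply: transf_eqP => i; rewrite transfM mergeE ffunE.
  case: (i =P x') => [->|/eqP/negPf->] //.
  by rewrite eq_sym (negPf xy').
rewrite sE endoM (merge_conj_eq xy').
have [/imsetP[g _ ->]|s'_sing] := boolP (s' \in Sn n).
  exact: merge_mul_perm.
rewrite IH // -?endoM ?merge_idem //; rewrite ltnS in lt_m.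
apply: leq_trans lt_m; apply: proper_card.
rewrite properE; apply/andP; split.
  rewrite setCS; apply/subsetP=> _ /imsetP[i _ ->].
  apply/imsetP; case: (i =P x') => [->|/eqP/negPf ix].
    by exists y' => //; rewrite ffunE eq_sym (negPf xy').
  by exists i => //; rewrite ffunE ix.
apply/subsetPn; exists z => //; rewrite inE negbK; apply/imsetP.
by exists x' => //; rewrite ffunE eqxx.
Qed.
End Merge.

Lemma endo_phi : exists t e, phi_pair t e /\ fun_of_endo a = phi t e.
Proof.
pose x : 'I_n := Ordinal (ltn_trans (isT : 0 < 4)%N n_ge5).
pose y : 'I_n := Ordinal (ltn_trans (isT : 1 < 4)%N n_ge5).
have xy : x != y by [].
have tt : a (perm_transf (tperm x y)) * a (perm_transf (tperm x y)) = a 1.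
  by rewrite -endoM -perm_transfM tperm2 perm_transf1.
exists (a (perm_transf (tperm x y))), (a (merge x y)); split.
  split; last by rewrite -endoM merge_idem.
  - by rewrite tt endo1l.
  - exact: perm_mul_merge.
  - exact: merge_mul_perm.
apply/ffunP=> s; have [/imsetP[g _ ->]|s_sing] := boolP (s \in Sn n); last first.
  by rewrite phi_sing // (endo_sing xy).
have [g_odd|g_even] := boolP (odd_perm g).
  rewrite phi_odd ?perm_in_Sn ?perm_in_An ?negbK //.
  by apply: endo_odd; rewrite ?odd_tperm.
by rewrite phi_even ?perm_in_An // tt endo_even.
Qed.

End NotInjectiveOnPermutations.

Lemma endo_cases : (exists g, a = conj_endo g) \/
  (exists t e, phi_pair t e /\ fun_of_endo a = phi t e).
Proof.
have [/injectiveP a_inj|a_ninj] :=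
  boolP (injectiveb [ffun g => a (perm_transf g)]).
  by left; apply: endo_inner => g h gh; apply: a_inj; rewrite !ffunE.
right; apply: endo_phi => a_inj; move/injectiveP: a_ninj; apply=> g h.
by rewrite !ffunE; apply: a_inj.
Qed.

End Classification.

(** * Left kernels of endomorphisms *)

Section Conjugation.
Local Open Scope group_scope.
Variable n : nat.
Implicit Types (s t e u f v k : transf n) (g h : 'S_n).

Lemma transf_conjM s g h : transf_conj s (g * h) = transf_conj (transf_conj s g) h.
Proof. by rewrite /transf_conj invMg !perm_transfM !mulgA. Qed.

Lemma transf_conj1 s : transf_conj s 1 = s.
Proof. by rewrite /transf_conj invg1 perm_transf1 mul1g mulg1. Qed.

Lemma transf_conjK g : cancel (fun s => transf_conj s g) (fun s => transf_conj s g^-1).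
Proof. by move=> s; rewrite -transf_conjM mulgV transf_conj1. Qed.

Lemma transf_conj_inj g : injective (fun s => transf_conj s g).
Proof. exact: can_inj (transf_conjK g). Qed.

Lemma conj_one g : transf_conj 1 g = 1 :> transf n.
Proof. by rewrite /transf_conj mulg1 perm_transfVl. Qed.

Lemma conj_eq_mod s g h :
  (transf_conj s g == transf_conj s h) = (transf_conj s (g * h^-1) == s).
Proof.
rewrite transf_conjM; apply/eqP/eqP=> [->|E]; first exact: transf_conjK.
by rewrite -[in RHS]E -transf_conjM mulVg transf_conj1.
Qed.

Lemma conj_eq_Fix t e g h :
  transf_conj t g = transf_conj t h /\ transf_conj e g = transf_conj e h
  <-> g * h^-1 \in Fix t e.
Proof.
rewrite inE -!conj_eq_mod; split; first by case=> -> ->; rewrite !eqxx.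
by case/andP=> /eqP-> /eqP->.
Qed.

Lemma conj_endo_aut g : is_aut (conj_endo g).
Proof.
apply: injF_bij => s s'; rewrite !conj_endoE; exact: transf_conj_inj.
Qed.

End Conjugation.

Section Cancellation.
Local Open Scope group_scope.
Variable n : nat.
Implicit Types a b c d : endo n.

Lemma endo_mulE a b s : (a * b) s = b (a s).
Proof. by rewrite ffunE. Qed.

Lemma endo1E s : (1 : endo n) s = s.
Proof. by rewrite ffunE. Qed.

Lemma aut_cancel a : is_aut a -> forall c d, a * c = a * d -> c = d.
Proof.
case=> a' _ aK c d acd; apply: endo_eqP => s.
by rewrite -(aK s) -!endo_mulE acd.
Qed.

(** On the finite monoid of endomorphisms, left multiplication by [a] is onto as
   soon as it is injective, so [a] has a right inverse. *)
Lemma cancel_aut a : (forall c d, a * c = a * d -> c = d) -> is_aut a.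
Proof.
move=> a_cancel; have /codomP[c ac] := injF_onto (a_cancel : injective (mul a)) 1.
apply: injF_bij; apply: (can_inj (g := c)) => s.
by rewrite -endo_mulE -ac ffunE.
Qed.

Lemma Lstar_aut a b : Lstar a b -> is_aut a -> is_aut b.
Proof.
by move=> ab a_aut; apply: cancel_aut => c d /ab; apply: aut_cancel.
Qed.

Lemma Lstar_sym a b : Lstar a b -> Lstar b a.
Proof. by move=> ab c d; split=> /ab. Qed.

Lemma aut_Lstar a b : is_aut a -> is_aut b -> Lstar a b.
Proof. by move=> aA bA c d; split=> /aut_cancel->. Qed.

End Cancellation.

Section PhiProducts.
Local Open Scope group_scope.
Variables (n : nat) (n_gt1 : (1 < n)%N).
Implicit Types (s t e u f v k : transf n) (g h : 'S_n) (x y z : 'I_n).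
Implicit Types a b c d : endo n.

Let x0 : 'I_n := Ordinal (ltnW n_gt1).
Let x1 : 'I_n := Ordinal n_gt1.

Lemma phi_inj t e u f : phi t e = phi u f -> t = u /\ e = f.
Proof.
move=> E; have x01 : x0 != x1 by [].
have /ffunP tu := E; split.
  have := tu (perm_transf (tperm x0 x1)).
  by rewrite !phi_odd ?perm_in_Sn ?perm_in_An ?odd_tperm.
by have := tu (merge x0 x1); rewrite !phi_sing ?merge_sing.
Qed.

Lemma in_phi_set a t e (P : rel (transf n)) :
  fun_of_endo a = phi t e -> (a \in phi_set P) = P t e.
Proof.
move=> aE; rewrite inE; apply/existsP/idP => [[u /existsP[f /andP[Puf /eqP]]]|Pte].
  by rewrite aE => /phi_inj[-> ->].
by exists t; apply/existsP; exists e; rewrite Pte aE eqxx.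
Qed.

Lemma phi_mul_eq a t e c d : fun_of_endo a = phi t e ->
  a * c = a * d <-> c t = d t /\ c e = d e.
Proof.
move=> aE; split=> [acd | [ct ce]].
  have x01 : x0 != x1 by [].
  have ev s : c (a s) = d (a s) by rewrite -!endo_mulE acd.
  have := ev (merge x0 x1); have := ev (perm_transf (tperm x0 x1)).
  by rewrite aE phi_odd ?phi_sing ?merge_sing ?perm_in_Sn ?perm_in_An ?odd_tperm.
apply: endo_eqP => s; rewrite !endo_mulE aE ffunE.
by case: ifP => // _; case: ifP => // _; rewrite expg2 !endoM ct.
Qed.

Lemma endo_phi_pair a t e : fun_of_endo a = phi t e -> phi_pair t e.
Proof.
move=> aE; have x01 : x0 != x1 by [].
pose p : transf n := perm_transf (tperm x0 x1); pose m := merge x0 x1.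
have at_p : a p = t.
  by rewrite aE phi_odd ?perm_in_Sn ?perm_in_An ?odd_tperm.
have at_m s : s \notin Sn n -> a s = e by move=> sS; rewrite aE phi_sing.
have mS : m \notin Sn n by apply: merge_sing.
split.
- by rewrite -at_p -!endoM -!perm_transfM tperm2 mul1g.
- by rewrite -at_p -{1}(at_m m mS) -endoM tperm_merge at_m.
- rewrite -at_p -{1}(at_m m mS) -endoM at_m //.
  by apply: contra mS; apply: Sn_mull.
- by rewrite -(at_m m mS) -endoM merge_idem.
Qed.

Lemma pair_sing t e : phi_pair t e -> t != e -> e \notin Sn n.
Proof.
case=> _ te _ ee; apply: contra => eS.
by rewrite -te (Sn_idem eS ee) mulg1.
Qed.

Lemma pair_sq t e : phi_pair t e -> t \in Sn n -> t * t = 1.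
Proof.
case=> ttt _ _ _ tS; apply: Sn_idem; last by rewrite mulgA ttt.
by case/imsetP: tS => g _ ->; rewrite -perm_transfM perm_in_Sn.
Qed.

(** For [phi_pair t e], this is the joint condition of [classA], [classB] and
   [classC]; see [in_classes_ABC]. *)
Definition rigid t e :=
  (t != e) && ((t \notin Sn n) || (t \in An n) && (t != 1)).

Lemma in_classes_ABC a t e : phi_pair t e -> fun_of_endo a = phi t e ->
  (a \in classA :|: classB :|: classC) = rigid t e.
Proof.
move=> te aE; rewrite !in_setU !(in_phi_set _ aE) /rigid expg2.
have [te_eq|te_neq] /= := eqVneq t e.
  have [_ _ _ ee] := te; rewrite te_eq ee eqxx /= !andbF !orbF.
  by apply/and3P=> -[/An_Sn eS e1 _]; rewrite (Sn_idem eS ee) eqxx in e1.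
have eS := pair_sing te te_neq.
have -> : e != 1 by apply: contraNneq eS => ->; apply: one_in_Sn.
rewrite !andbT; have [tS|tS] /= := boolP (t \in Sn n); first by rewrite !orbF.
rewrite (contraNF (@An_Sn _ _) tS) /=.
have [//|tt_neq] /= := eqVneq t (t * t); rewrite orbF.
by apply: contra_neq te_neq => tt; have [ttt _ et _] := te; rewrite -[LHS]ttt tt.
Qed.

Lemma in_classes_E a t e : phi_pair t e -> fun_of_endo a = phi t e ->
  (a \in E3 :|: E2 :|: E1) = ~~ rigid t e.
Proof.
move=> te aE; rewrite !in_setU !(in_phi_set _ aE) /rigid in_setD.
have [te_eq|te_neq] /= := eqVneq t e; first by rewrite orbT.
have eS := pair_sing te te_neq.
have -> : e != 1 by apply: contraNneq eS => ->; apply: one_in_Sn.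
rewrite !andbT orbF negb_or negbK negb_and negbK.
have [->|_] := eqVneq t 1; first by rewrite orbT one_in_Sn orbT.
by rewrite !orbF andbC.
Qed.

(** The maps in [E1], [E2] and [E3] fix their own parameters [t] and [e]. *)
Lemma not_rigid_idem a t e : phi_pair t e -> fun_of_endo a = phi t e ->
  ~~ rigid t e -> a * a = a.
Proof.
move=> te aE; rewrite /rigid negb_and negbK => t_kind.
rewrite -[RHS]mulg1; apply/(phi_mul_eq _ _ aE); rewrite !ffunE aE.
have [te_eq|te_neq] := eqVneq t e.
  have [_ _ _ ee] := te; rewrite te_eq ffunE expg2 ee.
  by case: ifP => // _; case: ifP.
rewrite [phi t e e]phi_sing ?(pair_sing te) //; split=> //.
move: t_kind; rewrite (negPf te_neq) /= negb_or negbK => /andP[tS].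
rewrite negb_and negbK => /orP[tA|/eqP->]; first by rewrite phi_odd.
by rewrite phi_even ?one_in_An // mulg1.
Qed.

Lemma rigid_Sn t e : rigid t e -> (t \in Sn n) = (t \in An n).
Proof.
case/andP=> _ /orP[tS|/andP[tA _]]; last by rewrite tA An_Sn.
by rewrite (negPf tS) (contraNF (@An_Sn _ _) tS).
Qed.

(** As [E1], [E2] and [E3] are disjoint from these classes, the even type leaves
   only [classA], and the non-permutation type only [classB] and [classC]. *)
Lemma rigid_types a t e :
  phi_pair t e -> fun_of_endo a = phi t e -> rigid t e ->
  [/\ a \notin E3, (a \in classA :|: E2) = (t \in An n),
      (a \in classB :|: classC :|: (E1 :\: phi_id n)) = (t \notin An n)
    & a \notin phi_id n].
Proof.
move=> te aE te_rigid; have tSA := rigid_Sn te_rigid.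
have := in_classes_E te aE; rewrite te_rigid !in_setU => /norP[/norP[aE3 aE2] aE1].
have := in_classes_ABC te aE; rewrite te_rigid !in_setU -orbA.
have -> : a \notin phi_id n.
  apply: contra aE1; rewrite !(in_phi_set _ aE).
  by case/andP=> /eqP-> /eqP->.
rewrite aE3 in_setD (negPf aE2) (negPf aE1) andbF !orbF.
rewrite !(in_phi_set _ aE) !tSA.
by case: (t \in An n) => //=; rewrite !orbF => ->.
Qed.

(** If [t] is singular, its image under [phi v k] is [k], which is also the image
   of [e], whereas conjugation keeps [t] and [e] apart.  If [t] is an even
   involution, its image [v * v] is idempotent, but its conjugates are not. *)
Lemma rigid_not_mixed t e v k g : phi_pair t e -> rigid t e -> phi_pair v k ->
  transf_conj t g = phi v k t -> transf_conj e g = phi v k e -> False.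
Proof.
move=> te /andP[te_neq t_kind] vk; rewrite [phi v k e]phi_sing ?(pair_sing te) //.
case/orP: t_kind => [tS|/andP[tA t1]].
  by rewrite phi_sing // => <- /transf_conj_inj/eqP; rewrite eq_sym (negPf te_neq).
rewrite phi_even // => tg _; case/eqP: t1.
apply: (@transf_conj_inj _ g); rewrite conj_one.
have := congr1 (fun s => transf_conj s g) (pair_sq te (An_Sn tA)).
by rewrite perm_conj_mul conj_one tg mulgA; have [-> _ _ _] := vk.
Qed.

End PhiProducts.

(** * The relation Lstar on the maps phi *)

Section LstarPhi.
Local Open Scope group_scope.
Variables (n : nat) (n_ge5 : (5 <= n)%N).
Implicit Types (s t e u f v k : transf n) (g h : 'S_n) (x y z : 'I_n).
Implicit Types a b c d : endo n.

Let n_gt1 : (1 < n)%N := ltn_trans (isT : 1 < 4)%N n_ge5.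

Lemma phi_class_eq t u v k : (t \in An n) = (u \in An n) ->
  (t \in Sn n) = (u \in Sn n) -> phi v k t = phi v k u.
Proof. by move=> tuA tuS; rewrite !ffunE !inE tuA tuS. Qed.

(** A pair [c], [d] of maps [phi] relates through [t] only by the parity class of
   [t], a pair of conjugations only by [Fix t e], and mixed pairs are excluded. *)
Lemma rigid_transfer t e u f c d :
  phi_pair t e -> phi_pair u f -> rigid t e -> rigid u f ->
  (t \in An n) = (u \in An n) -> Fix t e = Fix u f ->
  c t = d t /\ c e = d e -> c u = d u /\ c f = d f.
Proof.
move=> te uf te_rigid uf_rigid tuA FixE.
have tuS : (t \in Sn n) = (u \in Sn n).
  by rewrite (rigid_Sn te_rigid) (rigid_Sn uf_rigid).
have eS : e \notin Sn n by apply: pair_sing te _; case/andP: te_rigid.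
have fS : f \notin Sn n by apply: pair_sing uf _; case/andP: uf_rigid.
have [[g ->]|[v [k [vk cE]]]] := endo_cases n_ge5 c;
  have [[h ->]|[w [l [wl dE]]]] := endo_cases n_ge5 d.
- by rewrite !conj_endoE => /conj_eq_Fix; rewrite FixE => /conj_eq_Fix.
- rewrite !conj_endoE dE => -[tg eg].
  by case: (rigid_not_mixed te te_rigid wl tg eg).
- rewrite !conj_endoE cE => -[tg eg].
  by case: (rigid_not_mixed te te_rigid vk (esym tg) (esym eg)).
- rewrite cE dE !(phi_class_eq _ _ tuA tuS) => -[-> kl]; split=> //.
  by move: kl; rewrite !phi_sing.
Qed.

Lemma rigid_Lstar a b t e u f :
  fun_of_endo a = phi t e -> fun_of_endo b = phi u f ->
  phi_pair t e -> phi_pair u f -> rigid t e -> rigid u f ->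
  (t \in An n) = (u \in An n) -> Fix t e = Fix u f -> Lstar a b.
Proof.
move=> aE bE te uf te_r uf_r tuA FixE c d.
split=> [/(phi_mul_eq n_gt1 _ _ aE) cd|/(phi_mul_eq n_gt1 _ _ bE) cd].
  by apply/(phi_mul_eq n_gt1 _ _ bE); apply: rigid_transfer cd.
by apply/(phi_mul_eq n_gt1 _ _ aE); apply: rigid_transfer cd.
Qed.

(** A map outside the three classes is related to [1] in its own left kernel,
   which is a mixed relation, and those are absent for [u] and [f]. *)
Lemma Lstar_rigid a b t e u f :
  fun_of_endo a = phi t e -> fun_of_endo b = phi u f ->
  phi_pair t e -> phi_pair u f -> Lstar a b -> rigid u f -> rigid t e.
Proof.
move=> aE bE te uf ab uf_rigid; apply: contraT => te_idem.
have /ab : a * a = a * 1 by rewrite mulg1 (not_rigid_idem n_gt1 te aE te_idem).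
move/(phi_mul_eq n_gt1 _ _ bE); rewrite aE => -[ut ft].
case: (@rigid_not_mixed _ u f t e 1 uf uf_rigid te).
  by rewrite ut ffunE transf_conj1.
by rewrite ft ffunE transf_conj1.
Qed.

(** The maps [phi 1 e] and [phi e e] agree on singular maps but not on even
   permutations, so they separate the even type from the non-permutation type. *)
Lemma Lstar_An a b t e u f :
  fun_of_endo a = phi t e -> fun_of_endo b = phi u f ->
  phi_pair t e -> phi_pair u f -> rigid t e -> rigid u f ->
  Lstar a b -> t \in An n -> u \in An n.
Proof.
move=> aE bE te uf te_rigid uf_rigid ab tA; apply: contraT => uA.
have [/andP[te_neq _] /andP[uf_neq _]] := (te_rigid, uf_rigid).
have eS := pair_sing te te_neq; have fS := pair_sing uf uf_neq.
have [_ _ _ ee] := te.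
have pair1 : phi_pair 1 e by split; rewrite ?mulg1 ?mul1g.
have paire : phi_pair e e by split; rewrite ?ee.
have /ab : b * phi_endo pair1 = b * phi_endo paire.
  by apply/(phi_mul_eq n_gt1 _ _ bE); rewrite /= !phi_sing // (rigid_Sn uf_rigid).
case/(phi_mul_eq n_gt1 _ _ aE) => + _; rewrite /= !phi_even // ee mulg1 => e1.
by rewrite -e1 one_in_Sn in eS.
Qed.

(** An element of [Fix t e] is one whose conjugation cannot be told from the
   identity after [phi t e]. *)
Lemma Lstar_Fix a b t e u f :
  fun_of_endo a = phi t e -> fun_of_endo b = phi u f ->
  Lstar a b -> Fix t e = Fix u f.
Proof.
move=> aE bE ab; apply/setP=> g.
have Fix_mul c v k : fun_of_endo c = phi v k ->
    c * conj_endo g = c * conj_endo 1 <-> g \in Fix v k.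
  have gE : g = g * 1^-1 by rewrite invg1 mulg1.
  move=> cE; rewrite {2}gE; split.
    by move/(phi_mul_eq n_gt1 _ _ cE); rewrite !conj_endoE => /conj_eq_Fix.
  by move/conj_eq_Fix=> E; apply/(phi_mul_eq n_gt1 _ _ cE); rewrite !conj_endoE.
apply/idP/idP=> [/(Fix_mul _ _ _ aE)/ab|/(Fix_mul _ _ _ bE)/ab].
  by move/(Fix_mul _ _ _ bE).
by move/(Fix_mul _ _ _ aE).
Qed.

(** The products say that [b] fixes [t] and [e], and [a] fixes [u] and [f].  A map
   of the form [phi] takes one value on singular maps, so [e] and [f] agree once
   both are singular; comparing parities of [t] and [u] leaves only [t = u]. *)
Lemma phi_mul_absorb_eq a b t e u f :
  fun_of_endo a = phi t e -> fun_of_endo b = phi u f ->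
  phi_pair t e -> phi_pair u f -> a * b = a -> b * a = b -> a = b.
Proof.
move=> aE bE te uf ab ba.
have [bt be] : b t = t /\ b e = e.
  by move: ab; rewrite -[RHS]mulg1 => /(phi_mul_eq n_gt1 _ _ aE); rewrite !endo1E.
have [au af] : a u = u /\ a f = f.
  by move: ba; rewrite -[RHS]mulg1 => /(phi_mul_eq n_gt1 _ _ bE); rewrite !endo1E.
suff [tu ef] : t = u /\ e = f by apply: endo_eqP => s; rewrite aE bE tu ef.
(* When its two parameters agree, the map is constant. *)
have constE v w : phi_pair v v -> phi v v w = v.
  by case=> _ _ _ vv; rewrite ffunE expg2 vv; case: ifP => //; case: ifP.
rewrite aE in au af; rewrite bE in bt be.
have [te_eq|te_neq] := eqVneq t e.
  rewrite -te_eq in te au af *.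
  by rewrite -au -af !constE.
have [uf_eq|uf_neq] := eqVneq u f.
  rewrite -uf_eq in uf bt be *.
  by rewrite -bt -be !constE.
have eS := pair_sing te te_neq; have fS := pair_sing uf uf_neq.
have ef : e = f by rewrite -be phi_sing.
split=> //; have [tS|tS] := boolP (t \in Sn n); last first.
  by case/eqP: te_neq; rewrite -bt phi_sing.
have [uS|uS] := boolP (u \in Sn n); last first.
  by case/eqP: uf_neq; rewrite -au phi_sing.
have [tA|tA] := boolP (t \in An n); last by rewrite -bt phi_odd.
have [uA|uA] := boolP (u \in An n); last by rewrite -[RHS]au phi_odd.
by rewrite -bt -[RHS]au !phi_even // (pair_sq te) // (pair_sq uf).
Qed.

End LstarPhi.

Theorem proposition6p9 (n : nat) (hn : 5 <= n) (a b : endo n) :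
  Lstar a b <->
  [\/ is_aut a /\ is_aut b,
      [/\ a \in E3 :|: E2 :|: E1, b \in E3 :|: E2 :|: E1 & a = b] |
      [/\ a \in classA :|: classB :|: classC,
          b \in classA :|: classB :|: classC &
          exists t e u f : transf n,
            [/\ fun_of_endo a = phi t e, fun_of_endo b = phi u f,
                same_type a b & Fix t e = Fix u f]]].
Proof.
have n_gt1 : 1 < n by apply: ltn_trans hn.
split=> [ab|].
  have [[g aE]|[t [e [te aE]]]] := endo_cases hn a.
    have a_aut : is_aut a by rewrite aE; apply: conj_endo_aut.
    by apply: Or31; split=> //; apply: Lstar_aut ab a_aut.
  have [[g bE]|[u [f [uf bE]]]] := endo_cases hn b.
    have b_aut : is_aut b by rewrite bE; apply: conj_endo_aut.
    by apply: Or31; split=> //; apply: Lstar_aut (Lstar_sym ab) b_aut.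
  have rigid_eq : rigid t e = rigid u f.
    have := Lstar_rigid hn aE bE te uf ab.
    have := Lstar_rigid hn bE aE uf te (Lstar_sym ab).
    by move=> ? ?; apply/idP/idP.
  have [te_rigid|te_idem] := boolP (rigid t e); last first.
    have uf_idem : ~~ rigid u f by rewrite -rigid_eq.
    apply: Or32; split.
    - by rewrite (in_classes_E n_gt1 te aE).
    - by rewrite (in_classes_E n_gt1 uf bE).
    have aa := not_rigid_idem n_gt1 te aE te_idem.
    have bb := not_rigid_idem n_gt1 uf bE uf_idem.
    apply: (phi_mul_absorb_eq hn aE bE te uf).
      by have /ab := etrans bb (esym (mulg1 b)); rewrite mulg1.
    by have /ab := etrans aa (esym (mulg1 a)); rewrite mulg1.
  have uf_rigid : rigid u f by rewrite -rigid_eq.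
  have tuA : (t \in An n) = (u \in An n).
    apply/idP/idP; first exact: (Lstar_An hn aE bE te uf te_rigid uf_rigid ab).
    exact: (Lstar_An hn bE aE uf te uf_rigid te_rigid (Lstar_sym ab)).
  apply: Or33; split.
  - by rewrite (in_classes_ABC n_gt1 te aE).
  - by rewrite (in_classes_ABC n_gt1 uf bE).
  exists t, e, u, f; split=> //; last exact: (Lstar_Fix hn aE bE ab).
  have [_ aA aBC _] := rigid_types n_gt1 te aE te_rigid.
  have [_ bA bBC _] := rigid_types n_gt1 uf bE uf_rigid.
  have [tA|tA] := boolP (t \in An n).
    by exists EvenType; rewrite /= aA bA -tuA.
  by exists NonPermType; rewrite /= aBC bBC -tuA.
case=> [[aA bA]|[_ _ ->] //|[aABC bABC [t [e [u [f [aE bE [ty ab_ty] FixE]]]]]]].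
  exact: aut_Lstar.
have te := endo_phi_pair n_gt1 aE; have uf := endo_phi_pair n_gt1 bE.
rewrite (in_classes_ABC n_gt1 te aE) in aABC.
rewrite (in_classes_ABC n_gt1 uf bE) in bABC.
have [aE3 aA aBC aid] := rigid_types n_gt1 te aE aABC.
have [bE3 bA bBC bid] := rigid_types n_gt1 uf bE bABC.
case: ty ab_ty => /=.
- by case; apply: aut_Lstar.
- by case; rewrite (negPf aE3).
- rewrite aA bA => -[tA uA].
  by apply: (rigid_Lstar hn aE bE te uf) => //; rewrite tA uA.
- rewrite aBC bBC => -[tA uA].
  by apply: (rigid_Lstar hn aE bE te uf) => //; rewrite (negPf tA) (negPf uA).
by case; rewrite (negPf aid).
Qed.
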